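(* Let $\Omega$ be a nonempty finite set (of columns), and let $(A_B)_{B\in\mathcal B}$ be a finite indexed family of subsets of $\Omega$ with $|A_B|\ge2$ for every $B$, such that every column belongs to at least one $A_B$. Consider all choices of three subsets $J_B^0,J_B^1,J_B^*\subseteq A_B$ of size $\lfloor|A_B|/2\rfloor$ for every $B\in\mathcal B$, and for such a choice put $$D_\lambda=\sum_{B\in\mathcal B}\bigl(\mathbf 1_{\{\lambda\in J_B^0\}}+\mathbf 1_{\{\lambda\in J_B^1\}}-2\,\mathbf 1_{\{\lambda\in J_B^*\}}\bigr)\in\mathbb Z\qquad(\lambda\in\Omega).$$ Among all such choices for which $D_\lambda\ne0$ for every $\lambda\in\Omega$, the minimum of $\max_{\lambda\in\Omega}|D_\lambda|$ equals $1$ if every connected component of the incidence graph has an even number of column vertices, and equals $2$ otherwise.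
   Context: The incidence graph is the bipartite graph with vertex classes $\mathcal B$ and $\Omega$ (column vertices), with an edge $B\lambda$ exactly when $\lambda\in A_B$. The family is indexed, so equal supports may occur for different $B$. *)

(* Defs.v *)
From mathcomp Require Import all_boot all_order all_algebra.

Set Implicit Arguments.
Unset Strict Implicit.
Unset Printing Implicit Defensive.

Import GRing.Theory Num.Theory.

Section Defs.

Variables (Omega I : finType) (A : I -> {set Omega}).

Definition incidence : rel (I + Omega) := fun u v =>
  match u, v with
  | inl B, inr l => l \in A B
  | inr l, inl B => l \in A B
  | _, _ => false
  end.

(* [incidence] is symmetric, so [connect incidence] is an equivalence relation
   and its classes are the connected components. *)
Lemma incidence_sym : symmetric incidence.
Proof. by case=> [B|l] [B'|l']. Qed.

Definition components : {set {set I + Omega}} :=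
  equivalence_partition (connect incidence) [set: I + Omega].

Definition columns (C : {set I + Omega}) : {set Omega} :=
  [set l | inr l \in C].

Definition all_components_even : bool :=
  [forall C in components, ~~ odd #|columns C|].

Definition half_choice (J : I -> {set Omega}) : Prop :=
  forall B, J B \subset A B /\ #|J B| = #|A B|./2.

Definition discrepancy (J0 J1 Js : I -> {set Omega}) (l : Omega) : int :=
  (\sum_(B : I) ((l \in J0 B)%:Z + (l \in J1 B)%:Z - 2 * (l \in Js B)%:Z))%R.

Definition admissible (J0 J1 Js : I -> {set Omega}) : Prop :=
  [/\ half_choice J0, half_choice J1, half_choice Js
    & forall l, discrepancy J0 J1 Js l <> 0%R].

Definition max_discrepancy (J0 J1 Js : I -> {set Omega}) : nat :=
  \max_(l : Omega) `|discrepancy J0 J1 Js l|%N.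

Definition attained (m : nat) : Prop :=
  exists J0 J1 Js, admissible J0 J1 Js /\ max_discrepancy J0 J1 Js = m.

End Defs.

Definition is_minimum (P : nat -> Prop) (m : nat) : Prop :=
  P m /\ forall k, P k -> m <= k.

(* Main.v *)
Require Import Defs.
From mathcomp Require Import all_boot all_order all_algebra.
From mathcomp Require Import zify ring.

Set Implicit Arguments.
Unset Strict Implicit.
Unset Printing Implicit Defensive.

Import GRing.Theory Num.Theory.

(** In a choice of half-size sets, block [B] contributes to the discrepancy the
    integer vector [1_{J0 B} + 1_{J1 B} - 2 * 1_{Js B}], supported on [A B] and
    of zero sum, because the three sets have the same size. Summing over a
    component [C] of the incidence graph, the discrepancies of the columns of
    [C] add up to zero. If all of them are [1] or [-1], then [C] has an even
    number of columns. This is the lower bound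
    ([component_sum], [discrepancy_lower_bound]).

    For the upper bound, first look for one vector [x B] per block, with entries
    in [{-1, 0, 1}] and zero sum, such that the column sums are [1] or [-1]
    except at one column at most of each component, where the sum is [0]. The
    support of such an [x] is a subgraph of the incidence graph in which every
    block has even degree. Conversely, any subgraph has a balanced signing: signs
    on its edges whose sum at each vertex has absolute value at most [1]
    ([balanced_signing]), hence sum [0] at vertices of even degree and [1] or
    [-1] at the others. So it suffices to find a subgraph with all blocks of even
    degree and as few columns of even degree as possible: if two columns of a
    component have even degree, adding modulo 2 a path between them makes both
    odd and changes no other parity, so at most one is left per component
    ([even_subgraph]). By parity none is left in a component with an even number
    of columns ([all_even_nonzero]).

    A left-over column [a], of sum [0], lies in some block together with another
    column [b], whose sum [D b] is then [1] or [-1]. Subtract [D b] from the entry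
    of this block at [a] and add it at [b]: the sums at [a] and [b] become
    [- D b] and [2 * D b], and no other sum changes ([corrected_family]).

    Finally, a zero-sum vector [y] on [A B] with entries of absolute value at
    most [2] comes from three half-size sets as soon as the number of its
    positive entries exceeds the number of its negative ones by [0] or [1]
    ([half_sets_of_vector]). The column [b] above is picked so that the
    corrected vector keeps this property ([partner_exists],
    [transfer_sign_excess]). *)

(** * Finite sums and parities *)

Lemma odd_absz_sum (T : finType) (P : pred T) (F : T -> int) :
  odd `|(\sum_(i | P i) F i)%R| = \big[addb/false]_(i | P i) odd `|F i|.
Proof.
apply: (big_morph (fun z : int => odd `|z|)) => // m n; lia.
Qed.

Lemma big_addb_pred1 (T : finType) (t : T) :
  \big[addb/false]_i (i == t) = true.
Proof. by rewrite (bigD1 t) //= eqxx big1 // => i /negPf. Qed.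

Lemma big_addb_true (T : finType) (X : {set T}) :
  \big[addb/false]_(i in X) true = odd #|X|.
Proof.
rewrite -sum1_card (big_morph odd oddD (erefl : odd 0 = false)).
exact: eq_bigr.
Qed.

Lemma sum_kronecker (T : finType) (F : T -> int) (t : T) :
  (\sum_i (t == i)%:Z * F i = F t)%R.
Proof.
rewrite (bigD1 t) //= eqxx mul1r big1 ?addr0 // => i.
by rewrite eq_sym => /negPf ->; rewrite mul0r.
Qed.

(** * Balanced signings of graphs *)

(** Any multigraph, loops allowed, can be oriented so that in-degree and
    out-degree differ by at most 1 at each vertex. The edges are the elements of
    [S]; an edge is given by its incidence vector [d e], the difference of the
    indicators of its two ends, and [c] says which edges to reverse. The proof
    splits off edges: two edges [v - z] and [v - z'] sharing the vertex [v] are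
    replaced by a single edge [z - z'], and an orientation of that edge lifts to
    a passage through [v], which contributes nothing at [v] and the same at
    [z] and [z']. When no two edges share a vertex, any orientation works. *)
Lemma balanced_orientation (V E : finType) (S : {set E}) (d : E -> V -> int) :
  (forall e, e \in S ->
     exists x y, forall v, d e v = ((v == x)%:Z - (v == y)%:Z)%R) ->
  exists c : E -> bool,
    forall v, `|(\sum_(e in S) (-1) ^+ c e * d e v)%R| <= 1.
Proof.
have [n] := ubnP #|S|; elim: n S d => // n IHn S d /ltnSE leSn dE.
have normalize e v : e \in S -> d e v != 0%R -> exists (s : bool) (z : V),
    forall w, d e w = ((-1) ^+ s * ((w == v)%:Z - (w == z)%:Z))%R.
  move=> /dE[x [y exy]]; rewrite exy.
  have [->|_] := eqVneq v x.
    by exists false, y => w; rewrite exy mul1r.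
  have [->|_ //] := eqVneq v y.
  by exists true, x => w; rewrite exy; ring.
have [/exists_inP[e eS /exists_inP[e' e'S /existsP[v /and3P[nee' nz nz']]]]|] :=
  boolP [exists e in S, exists e' in S,
         exists v, [&& e != e', d e v != 0%R & d e' v != 0%R]].
  have [s [z ez]] := normalize e v eS nz.
  have [s' [z' ez']] := normalize e' v e'S nz'.
  have eS' : e \in S :\ e' by rewrite !inE nee'.
  (* [e] now stands for the edge from [z] to [z'] and [e'] is removed. *)
  pose d' f w := if f == e then ((w == z')%:Z - (w == z)%:Z)%R else d f w.
  have [||c cP] := IHn (S :\ e') d'.
  - by move: leSn; rewrite (cardsD1 e' S) e'S.
  - move=> f /setD1P[_ fS]; rewrite /d'.
    by case: eqP => [_|_]; [exists z', z | exact: dE].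
  exists (fun f => if f == e then c e (+) s
                   else if f == e' then ~~ (c e (+) s') else c f) => w.
  have := cP w; congr (`|_| <= 1).
  rewrite (big_setD1 e' e'S) !(big_setD1 e eS') /= eqxx.
  rewrite eq_sym (negPf nee') eqxx /d' eqxx addrA ez ez'.
  congr (_ + _)%R; last first.
    by apply: eq_bigr => f /setD1P[/negPf -> /setD1P[/negPf -> _]].
  by case: (c e) (s) (s') => [] [] [] /=; ring.
rewrite negb_exists_in => /forall_inP noshare.
exists (fun=> false) => v.
have [e /andP[eS nz]|z0] := pickP [pred e | (e \in S) && (d e v != 0%R)].
  rewrite (bigD1 e) //= big1 ?addr0 ?mul1r; last first.
    move=> f /andP[fS fe]; apply/eqP; rewrite mul1r; apply/negPn.
    apply: contra (noshare e eS) => nzf; apply/exists_inP; exists f => //.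
    by apply/existsP; exists v; rewrite eq_sym fe nz.
  have [x [y ->]] := dE e eS; lia.
rewrite big1 // => e eS; rewrite mul1r; apply/eqP.
by have := z0 e; rewrite /= eS => /negbT; rewrite negbK.
Qed.

Lemma balanced_signing (I Omega : finType) (f : I -> Omega -> bool) :
  exists x : I -> Omega -> int,
    [/\ forall B l, `|x B l|%N = f B l,
        forall B, `|(\sum_l x B l)%R| <= 1
      & forall l, `|(\sum_B x B l)%R| <= 1].
Proof.
pose S := [set e : I * Omega | f e.1 e.2].
pose d (e : I * Omega) (v : I + Omega) : int :=
  ((v == inr e.2)%:Z - (v == inl e.1)%:Z)%R.
have [|c cP] := @balanced_orientation _ _ S d.
  by move=> e _; exists (inr e.2), (inl e.1).
exists (fun B l => if f B l then ((-1) ^+ c (B, l))%R else 0%R).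
have sumE v : (\sum_(e in S) (-1) ^+ c e * d e v =
    \sum_B \sum_l (if f B l then (-1) ^+ c (B, l) else 0) * d (B, l) v)%R.
  rewrite pair_big /= big_mkcond /=; apply: eq_bigr => -[B l] _.
  by rewrite inE /=; case: ifP => // _; rewrite mul0r.
split=> [B l|B|l].
- by case: (f B l) => //; case: (c _).
- have := cP (inl B); rewrite sumE exchange_big /=.
  under eq_bigr => l _.
    under eq_bigr => B' _ do rewrite /d /= sub0r mulrN mulrC.
    rewrite sumrN.
    over.
  rewrite sumrN abszN; congr (`|_| <= 1); apply: eq_bigr => l _.
  by rewrite (sum_kronecker (fun B => if f B l then ((-1) ^+ c (B, l))%R else 0%R)).
- have := cP (inr l); rewrite sumE.
  congr (`|_| <= 1); apply: eq_bigr => B _.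
  under eq_bigr => l' _ do rewrite /d /= subr0 mulrC.
  by rewrite (sum_kronecker (fun l => if f B l then ((-1) ^+ c (B, l))%R else 0%R)).
Qed.

(** * Subgraphs with blocks of even degree *)

(** Subgraphs of the incidence graph are boolean matrices [f], so that their sum
    modulo 2 is the pointwise [addb]; [parity f n] is the parity of the degree of
    the vertex [n] in [f]. *)
Definition parity (I Omega : finType) (f : I -> Omega -> bool)
    (n : I + Omega) : bool :=
  match n with
  | inl B => \big[addb/false]_l f B l
  | inr l => \big[addb/false]_B f B l
  end.

Lemma parityD (I Omega : finType) (f g : I -> Omega -> bool) n :
  parity (fun B l => f B l (+) g B l) n = parity f n (+) parity g n.
Proof. by case: n => n /=; rewrite big_split. Qed.

Lemma parity_edge (I Omega : finType) (B0 : I) (l0 : Omega) n :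
  parity (fun B l => (B == B0) && (l == l0)) n
  = (n == inl B0) (+) (n == inr l0).
Proof.
case: n => [B|l] /=.
  have [->|nB] := eqVneq B B0; first by rewrite /= big_addb_pred1 eqxx.
  rewrite big1 // -[inl B == inl B0]/(B == B0) (negPf nB) //.
have [->|nl] := eqVneq l l0.
  under eq_bigr do rewrite andbT.
  by rewrite big_addb_pred1 /= eqxx.
rewrite big1 => [|B _]; last by rewrite andbF.
by rewrite -[inr l == inr l0]/(l == l0) (negPf nl).
Qed.

(** The sum modulo 2 of the edges of a walk from [u] to [n]: every passage through
    a vertex uses two edges, so only the end points can have odd degree. *)
Lemma connecting_subgraph (I Omega : finType) (A : I -> {set Omega}) u n :
  connect (incidence A) u n ->
  exists f : I -> Omega -> bool, (forall B l, f B l -> l \in A B) /\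
    forall m, parity f m = (m == u) (+) (m == n).
Proof.
move=> /connectP[p]; elim: p u => [|w p IHp] u /=.
  move=> _ ->; exists (fun _ _ => false); split=> // m.
  by rewrite addbb; case: m => m /=; rewrite big1.
move=> /andP[uw wp] nE; have [f [fA fP]] := IHp w wp nE.
have [B [l [lB uwE]]] : exists B l, l \in A B /\
    forall m, (m == u) (+) (m == w) = (m == inl B) (+) (m == inr l).
  case: u w uw {wp nE fP IHp} => [B|l] [B'|l'] //= lB.
    by exists B, l'.
  by exists B', l; split=> // m; rewrite addbC.
exists (fun B' l' => ((B' == B) && (l' == l)) (+) f B' l'); split=> [B' l'|m].
  case E: (_ && _) => /=; last exact: fA.
  by move: E => /andP[/eqP -> /eqP ->].
by rewrite parityD parity_edge -uwE fP -!addbA; congr (_ (+) _); rewrite addbA addbb.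
Qed.

(** While a component contains two columns of even degree, adding modulo 2 a path
    between them makes both degrees odd and keeps all other parities; the number
    of columns of even degree decreases, so this stops. *)
Lemma even_subgraph (I Omega : finType) (A : I -> {set Omega}) :
  exists f : I -> Omega -> bool,
    [/\ forall B l, f B l -> l \in A B,
        forall B, parity f (inl B) = false
      & forall u v, parity f (inr u) = false -> parity f (inr v) = false ->
          connect (incidence A) (inr u) (inr v) -> u = v].
Proof.
suff: forall n f, #|[set l | ~~ parity f (inr l)]| < n ->
    (forall B l, f B l -> l \in A B) -> (forall B, parity f (inl B) = false) ->
    exists f : I -> Omega -> bool,
    [/\ forall B l, f B l -> l \in A B,
        forall B, parity f (inl B) = false
      & forall u v, parity f (inr u) = false -> parity f (inr v) = false ->
          connect (incidence A) (inr u) (inr v) -> u = v].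
  move=> /(_ _ (fun _ _ => false) (ltnSn _)); apply=> // B /=.
  by rewrite big1.
elim=> // n IHn f /ltnSE lt_n fA fB.
pose bad u v := [&& u != v, ~~ parity f (inr u), ~~ parity f (inr v)
                 & connect (incidence A) (inr u) (inr v)].
have [/existsP[u /existsP[v /and4P[nuv pu pv uv]]]|] :=
  boolP [exists u, exists v, bad u v]; last first.
  move=> nobad; exists f; split=> // u v pu pv uv; apply/eqP/negPn.
  apply: contra nobad => nuv; apply/existsP; exists u; apply/existsP; exists v.
  by rewrite /bad nuv pu pv.
have [g [gA gP]] := connecting_subgraph uv.
apply: (IHn (fun B l => f B l (+) g B l)) => [|B l|B].
- apply: leq_trans lt_n; apply: proper_card; apply/properP; split.
    apply/subsetP => l; rewrite !inE parityD gP.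
    rewrite !(inj_eq (@inr_inj _ _)).
    have [->|_] := eqVneq l u; first by rewrite pu.
    have [->|_] := eqVneq l v; first by rewrite pv.
    by rewrite /= addbF.
  exists u; rewrite inE // parityD gP eqxx (negPf pu).
  by rewrite (inj_eq (@inr_inj _ _)) (negPf nuv).
- by case fBl: (f B l) => /=; [rewrite fA | apply: gA].
- by rewrite parityD fB gP.
Qed.

(** * Vectors obtained from three half-size sets *)

Lemma intermediate_set (T : finType) (X Y : {set T}) k :
  X \subset Y -> #|X| <= k <= #|Y| ->
  exists Z : {set T}, [/\ X \subset Z, Z \subset Y & #|Z| = k].
Proof.
move=> XY /andP[Xk]; elim: k Xk => [|k IHk].
  by rewrite leqn0 => X0 _; exists X; split=> //; apply/eqP.
rewrite leq_eqVlt => /orP[/eqP <- _|Xk kY]; first by exists X.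
have [Z [XZ ZY Zk]] := IHk Xk (ltnW kY).
have /subsetPn[t tY tZ] : ~~ (Y \subset Z).
  by apply: contraL kY => /subset_leq_card; rewrite Zk -leqNgt.
exists (t |: Z); split.
- exact: subset_trans XZ (subsetUr _ _).
- by rewrite subUset sub1set tY.
- by rewrite cardsU1 tZ Zk.
Qed.

Lemma sum_mem_card (T : finType) (X : {set T}) :
  (\sum_t (t \in X)%:Z = #|X|%:Z)%R.
Proof.
rewrite -sum1_card (big_morph Posz PoszD (erefl : Posz 0 = 0%R)) [RHS]big_mkcond /=.
by apply: eq_bigr => t _; case: ifP.
Qed.

Definition sign_excess (T : finType) (y : T -> int) : int :=
  (\sum_t ((0 < y t)%R%:Z - (y t < 0)%R%:Z))%R.

(** The set [Js] must contain the negative entries of [y] and avoid the positive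
    ones; the hypothesis on [sign_excess] says that there are at most
    [#|A|./2] negative entries and at most [uphalf #|A|] positive ones, which
    leaves room for [Js]. Then membership in [J0] and [J1] is forced wherever
    [y] is even, and at each odd entry exactly one of [J0] and [J1] has the
    column. Sharing the odd entries equally gives [J0] and [J1] the same size,
    and this size is right because [y] has zero sum. The three sets are returned
    as one triple so that a single choice over all blocks selects them. *)
Lemma half_sets_of_vector (Omega : finType) (A : {set Omega}) (y : Omega -> int) :
  (forall l, l \notin A -> y l = 0%R) -> (forall l, `|y l| <= 2) ->
  (\sum_l y l = 0)%R ->
  (0 <= sign_excess y <= 1)%R ->
  exists J : {set Omega} * {set Omega} * {set Omega},
    [/\ J.1.1 \subset A /\ #|J.1.1| = #|A|./2,
        J.1.2 \subset A /\ #|J.1.2| = #|A|./2,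
        J.2 \subset A /\ #|J.2| = #|A|./2
      & forall l, y l = ((l \in J.1.1)%:Z + (l \in J.1.2)%:Z
                         - 2 * (l \in J.2)%:Z)%R].
Proof.
move=> yA y2 y0 excess.
pose N := [set l | (y l < 0)%R]; pose P := [set l | (0 < y l)%R].
have inA l : y l != 0%R -> l \in A by apply: contraNT => /yA ->.
have NA : N \subset A by apply/subsetP=> l; rewrite inE => yl; apply: inA; lia.
have PA : P \subset A by apply/subsetP=> l; rewrite inE => yl; apply: inA; lia.
have NP0 : N :&: P = set0 by apply/setP=> l; rewrite !inE; lia.
have leNP : #|N| + #|P| <= #|A|.
  by rewrite -cardsUI NP0 cards0 addn0 subset_leq_card // subUset NA.
have excessE : sign_excess y = (#|P|%:Z - #|N|%:Z)%R.
  rewrite -!sum_mem_card -sumrB; apply: eq_bigr => l _.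
  by rewrite !inE.
have [|| Js [NJ JAP Jk]] := @intermediate_set _ N (A :\: P) #|A|./2.
- apply/subsetP => l lN; rewrite in_setD (subsetP NA) // andbT.
  by move: lN; rewrite !inE; lia.
- by rewrite cardsD (setIidPr PA); move: excess; rewrite excessE; lia.
have JsA : Js \subset A by apply: subset_trans JAP (subsetDl _ _).
pose U := [set l | odd `|y l|].
have evenU : odd #|U| = false.
  have := odd_absz_sum xpredT y; rewrite y0 /= => ->.
  rewrite -big_addb_true big_mkcond /=; apply: eq_bigr => l _.
  by rewrite inE; case: odd.
have [|| W [_ WU Wk]] := @intermediate_set _ set0 U #|U|./2.
- exact: sub0set.
- by rewrite cards0 /=; have := odd_double_half #|U|; lia.
pose base := [set l | (y l == 2)%R || (l \in Js) && (y l == 0)%R].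
have disj (X : {set Omega}) : X \subset U -> [disjoint base & X].
  move=> XU; rewrite -setI_eq0; apply/eqP/setP=> l; rewrite !inE.
  by apply/negbTE/negP=> /andP[bl /(subsetP XU)]; rewrite inE; lia.
pose J0 := base :|: W; pose J1 := base :|: (U :\: W).
have subA (X : {set Omega}) : X \subset U -> base :|: X \subset A.
  move=> XU; apply/subsetP=> l; rewrite !inE => /orP[/orP[yl|/andP[lJ _]]|lX].
  - by apply: inA; lia.
  - exact: (subsetP JsA).
  - by apply: inA; move: (subsetP XU _ lX); rewrite inE; lia.
have UWU : U :\: W \subset U by exact: subsetDl.
have yE l : y l = ((l \in J0)%:Z + (l \in J1)%:Z - 2 * (l \in Js)%:Z)%R.
  have := y2 l; have := subsetP NJ l; have := subsetP JAP l.
  have := subsetP WU l; rewrite !inE.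
  by case: (l \in Js) (l \in W) => [] [] /=; clear; lia.
have cardJ : #|J0| = #|J1|.
  rewrite !cardsU !disjoint_setI0 ?disj // cards0 cardsD (setIidPr WU) Wk.
  by have := odd_double_half #|U|; rewrite evenU; lia.
have J0k : #|J0| = #|A|./2.
  move: y0; under eq_bigr do rewrite yE.
  rewrite !big_split /= sumrN -mulr_sumr !sum_mem_card Jk cardJ; lia.
exists (J0, J1, Js); split=> //=; split=> //; try exact: subA.
by rewrite -cardJ.
Qed.

(** * The sum over a component and the lower bound *)

(** A block lies in [C] together with all its columns, and then contributes its
    total [0], or it has no column in [C]. *)
Lemma component_sum (I Omega : finType) (A : I -> {set Omega})
    (C : {set I + Omega}) (y : I -> Omega -> int) :
  C \in components A ->
  (forall B l, l \notin A B -> y B l = 0%R) ->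
  (forall B, \sum_l y B l = 0)%R ->
  (\sum_(l in columns C) \sum_B y B l = 0)%R.
Proof.
case/imsetP=> u _ ->{C} yA y0.
rewrite exchange_big big1 //= => B _.
have [uB|uB] := boolP (connect (incidence A) u (inl B)).
  rewrite -{2}(y0 B) big_mkcond; apply: eq_bigr => l _.
  rewrite !inE /=; have [lB|/yA ->] := boolP (l \in A B); last by rewrite if_same.
  by rewrite (connect_trans uB (connect1 _)).
rewrite big1 // => l; rewrite !inE /= => ul; apply: yA.
by apply: contra uB => lB; apply: connect_trans ul (connect1 _).
Qed.

Lemma component_parity (I Omega : finType) (A : I -> {set Omega})
    (C : {set I + Omega}) (y : I -> Omega -> int) :
  C \in components A ->
  (forall B l, l \notin A B -> y B l = 0%R) ->
  (forall B, \sum_l y B l = 0)%R ->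
  \big[addb/false]_(l in columns C) odd `|(\sum_B y B l)%R| = false.
Proof. by move=> CA yA y0; rewrite -odd_absz_sum (component_sum CA). Qed.

Lemma discrepancy_lower_bound (I Omega : finType) (A : I -> {set Omega}) k :
  0 < #|Omega| -> attained A k -> (if all_components_even A then 1 else 2) <= k.
Proof.
move=> /card_gt0P[l0 _] [J0 [J1 [Js [[h0 h1 hs D0] <-]]]].
set M := max_discrepancy _ _ _.
have leM l : `|discrepancy J0 J1 Js l|%N <= M by apply: leq_bigmax_cond.
have M1 : 1 <= M by have := leM l0; have := D0 l0; lia.
have [//|/forall_inPn[C CA /negPn oddC]] := boolP (all_components_even A).
rewrite ltn_neqAle M1 andbT; apply: contraL oddC => /eqP M_1.
pose y B l : int := ((l \in J0 B)%:Z + (l \in J1 B)%:Z - 2 * (l \in Js B)%:Z)%R.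
have notin (J : I -> {set Omega}) B l :
    half_choice A J -> l \notin A B -> (l \in J B) = false.
  by move=> hJ; apply: contraNF; apply: subsetP (hJ B).1 l.
have <- : \big[addb/false]_(l in columns C) odd `|(\sum_B y B l)%R|
    = odd #|columns C|.
  rewrite -big_addb_true; apply: eq_bigr => l _.
  have := leM l; have := D0 l; rewrite -M_1.
  rewrite -[discrepancy _ _ _ _]/(\sum_B y B l)%R; lia.
rewrite (component_parity CA) // => [B l nl|B].
  by rewrite /y (notin J0) // (notin J1) // (notin Js).
rewrite !big_split /= sumrN -mulr_sumr !sum_mem_card.
by rewrite (h0 B).2 (h1 B).2 (hs B).2; lia.
Qed.

(** * Families of vectors with small column sums *)

(** A balanced signing of the subgraph of [even_subgraph]: a sum of absolute value
    at most 1 is determined up to sign by its parity, that is, by the parity of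
    the degree. *)
Lemma near_balanced_family (I Omega : finType) (A : I -> {set Omega}) :
  exists x : I -> Omega -> int,
    [/\ forall B l, l \notin A B -> x B l = 0%R,
        forall B l, `|x B l|%N <= 1,
        forall B, (\sum_l x B l = 0)%R,
        forall l, `|(\sum_B x B l)%R| <= 1
      & forall u v, (\sum_B x B u = 0)%R -> (\sum_B x B v = 0)%R ->
          connect (incidence A) (inr u) (inr v) -> u = v].
Proof.
have [f [fA fB fcol]] := even_subgraph A.
have [x [xf xB xl]] := balanced_signing f.
have zero_even l : (\sum_B x B l = 0)%R -> parity f (inr l) = false.
  move=> xl0; have <- : odd `|(\sum_B x B l)%R| = false by rewrite xl0.
  by rewrite odd_absz_sum /parity; apply: eq_bigr => B _; rewrite xf oddb.
exists x; split=> // [B l|B l|B|u v /zero_even pu /zero_even pv].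
- by move=> nl; apply/eqP; rewrite -absz_eq0 xf eqb0; apply: contra (fA B l) nl.
- by rewrite xf; case: (f B l).
- have: odd `|(\sum_l x B l)%R| = false.
    rewrite odd_absz_sum -[RHS](fB B) /parity.
    by apply: eq_bigr => l _; rewrite xf oddb.
  by have := xB B; lia.
- exact: fcol.
Qed.

(** A column of zero sum would be the only one of its component with an even sum;
    as the sums of the component add up to zero, the other columns would be even
    in number and the component would have an odd number of columns. *)
Lemma all_even_nonzero (I Omega : finType) (A : I -> {set Omega})
    (x : I -> Omega -> int) :
  (forall B l, l \notin A B -> x B l = 0%R) ->
  (forall B, \sum_l x B l = 0)%R ->
  (forall l, `|(\sum_B x B l)%R| <= 1) ->
  (forall u v, (\sum_B x B u = 0)%R -> (\sum_B x B v = 0)%R ->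
     connect (incidence A) (inr u) (inr v) -> u = v) ->
  all_components_even A -> forall l, (\sum_B x B l)%R <> 0%R.
Proof.
move=> xA x0 x1 xu /forall_inP even a Da0.
pose C := [set n in [set: I + Omega] | connect (incidence A) (inr a) n].
have CA : C \in components A by apply: imset_f; rewrite inE.
have inC l : l \in columns C = connect (incidence A) (inr a) (inr l).
  by rewrite !inE.
have := component_parity CA xA x0.
rewrite (eq_bigr (fun l => true (+) (l == a))) => [|l].
  rewrite big_split big_addb_true (negbTE (even C CA)) /=.
  by rewrite (bigD1 a) ?inC //= eqxx big1 // => l /andP[_ /negPf].
rewrite inC => al; have [->|nla] := eqVneq l a; first by rewrite Da0.
have: (\sum_B x B l)%R <> 0%R.
  by move=> Dl0; move/eqP: nla; apply; apply: esym; apply: xu.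
by have := x1 l; lia.
Qed.

(** The disjunction makes a transfer between [a] and [b] harmless for
    [sign_excess], whatever the direction of the transfer. When [x a] is nonzero,
    an entry of opposite sign exists since the sum is zero; when [x a] is zero,
    either there is an entry [-1], or [x] vanishes identically. A zero [x a]
    with an entry [1] at [b] must be excluded: the vector [(0, 1, -1)] could
    become [(-1, 2, -1)], which three singletons cannot produce. *)
Lemma partner_exists (T : finType) (S : {set T}) (x : T -> int) (a : T) :
  2 <= #|S| -> a \in S ->
  (forall t, t \notin S -> x t = 0%R) -> (forall t, `|x t| <= 1) ->
  (\sum_t x t = 0)%R ->
  exists b, [/\ b \in S, b != a
    & x b = (- x a)%R \/ x a = 0%R /\ x b = (- 1)%R].
Proof.
move=> S2 aS xS x1 x0.
have inS t : x t <> 0%R -> t \in S by move=> xt; apply/negPn/negP=> /xS.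
have [b xb|nonneg] := pickP [pred t | (x t * x a < 0)%R || (x a == 0)%R && (x t < 0)%R].
  exists b; split; move: xb => /=; have := x1 a; have := x1 b.
  - by move=> *; apply: inS; nia.
  - by move=> _ _; apply: contraTneq => ->; nia.
  - by nia.
have xa0 : x a = 0%R.
  have: (\sum_t x t * x a == 0)%R by rewrite -mulr_suml x0 mul0r.
  rewrite psumr_eq0 => [/allP/(_ a (mem_index_enum _))|t _].
    by rewrite mulf_eq0 orbb => /eqP.
  by have := nonneg t; rewrite /=; lia.
have xz t : x t = 0%R.
  move/eqP: x0; rewrite psumr_eq0 => [/allP/(_ t (mem_index_enum _))/eqP //|u _].
  by have := nonneg u; rewrite /= xa0; lia.
have /card_gt0P[b] : 0 < #|S :\ a| by move: S2; rewrite (cardsD1 a S) aS.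
by rewrite !inE => /andP[nba bS]; exists b; split=> //; left; rewrite !xz.
Qed.

(** Since the entries of [x] are their own signs, the sign excess of [x] is its sum
    [0], and the transfer changes it only through the signs at [a] and [b]. *)
Lemma transfer_sign_excess (T : finType) (x : T -> int) (a b : T) (s : int) :
  a != b -> (forall t, `|x t| <= 1) -> (\sum_t x t = 0)%R -> `|s| <= 1 ->
  (x b = (- x a)%R \/ x a = 0%R /\ x b = (- 1)%R) ->
  (0 <= sign_excess (fun t => x t + s * ((t == a)%:Z - (t == b)%:Z)) <= 1)%R.
Proof.
move=> nab x1 x0 s1 xab; rewrite /sign_excess.
pose g (z : int) : int := ((0 < z)%R%:Z - (z < 0)%R%:Z)%R.
rewrite (eq_bigr (fun t => x t + ((a == t)%:Z * (g (x t + s) - x t)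
   + (b == t)%:Z * (g (x t - s) - x t)))%R) => [|t _].
  rewrite !big_split /= x0 !sum_kronecker /g.
  have := x1 a; have := x1 b.
  by case: xab => [->|[-> ->]]; lia.
rewrite /g; have := x1 t.
rewrite [a == t]eq_sym [b == t]eq_sym.
have [->|_] := eqVneq t a; first by rewrite (negPf nab); lia.
by case: eqP => _; lia.
Qed.

(** Each column [a] of zero sum exchanges a unit with a column [mate a] of a common
    block [home a]. As a component contains at most one such [a], the corrections
    meet neither in a block nor in a column, and [mate a] has nonzero sum. *)
Lemma corrected_family (I Omega : finType) (A : I -> {set Omega}) :
  (forall B, 2 <= #|A B|) -> (forall l, exists B, l \in A B) ->
  exists y : I -> Omega -> int,
    [/\ forall B l, l \notin A B -> y B l = 0%R,
        forall B l, `|y B l|%N <= 2,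
        forall B, (\sum_l y B l = 0)%R,
        forall B, (0 <= sign_excess (y B) <= 1)%R
      & forall l, (\sum_B y B l)%R <> 0%R /\
          `|(\sum_B y B l)%R| <= if all_components_even A then 1 else 2].
Proof.
move=> A2 Acov; have [x [xA x1 x0 D1 Duniq]] := near_balanced_family A.
pose D l : int := (\sum_B x B l)%R.
pose Z l := D l == 0%R.
have [home homeP] := fin_all_exists Acov.
have [mate mateP] := fin_all_exists (fun a =>
  partner_exists (A2 (home a)) (homeP a) (xA (home a)) (x1 (home a)) (x0 (home a))).
have mateA a : mate a \in A (home a) by have [] := mateP a.
have mateN a : mate a != a by have [] := mateP a.
have Zuniq u v : Z u -> Z v -> connect (incidence A) (inr u) (inr v) -> u = v.
  by move=> /eqP Zu /eqP Zv; apply: Duniq.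
have two_steps B u v :
    u \in A B -> v \in A B -> connect (incidence A) (inr u) (inr v).
  move=> uB vB; apply: (@connect_trans _ _ (inl B)); exact: connect1.
have a_mate a : connect (incidence A) (inr a) (inr (mate a)).
  exact: two_steps (homeP a) (mateA a).
pose e a l : int := ((l == a)%:Z - (l == mate a)%:Z)%R.
pose s a : int := (- D (mate a))%R.
have s1 a : `|s a| <= 1 by rewrite abszN; apply: D1.
have sum_e a : (\sum_l e a l = 0)%R.
  have delta b : (\sum_l (l == b)%:Z = 1)%R.
    rewrite -[RHS](sum_kronecker (fun=> 1%R) b).
    by apply: eq_bigr => l _; rewrite mulr1 eq_sym.
  by rewrite sumrB !delta.
pose y B l : int := (x B l + \sum_(a | Z a && (home a == B)) s a * e a l)%R.
(* Two zero-sum columns with the same home would be connected. *)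
have yE B : y B =1 x B \/ exists2 a, home a = B &
    forall l, y B l = (x B l + s a * e a l)%R.
  have [a /andP[Za /eqP aB]|none] := pickP [pred a | Z a && (home a == B)].
    right; exists a => // l; congr (_ + _)%R.
    rewrite (big_pred1 a) // => a' /=; apply/andP/eqP=> [[Za' /eqP a'B]|-> //].
      apply: Zuniq => //; apply: (two_steps B); first by rewrite -a'B.
      by rewrite -aB.
    by rewrite aB.
  by left=> l; rewrite /y big_pred0 ?addr0.
exists y; split=> [B l lB|B l|B|B|l].
- case: (yE B) => [->|[a aB ->]]; rewrite xA // /e.
  have -> : (l == a) = false by apply: contraNF lB => /eqP ->; rewrite -aB.
  have -> : (l == mate a) = false by apply: contraNF lB => /eqP ->; rewrite -aB.
  by rewrite subrr mulr0.
- case: (yE B) => [->|[a aB ->]]; first exact: leq_trans (x1 B l) _.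
  have := x1 B l; have := s1 a; rewrite /e.
  have := mateN a; case: eqP => [->|_]; case: eqP => //=; lia.
- case: (yE B) => [yx|[a aB yx]]; first by rewrite (eq_bigr _ (fun l _ => yx l)).
  by rewrite (eq_bigr _ (fun l _ => yx l)) big_split /= x0 -mulr_sumr sum_e mulr0.
- have excess_eq (z : Omega -> int) : y B =1 z -> sign_excess (y B) = sign_excess z.
    by move=> yz; apply: eq_bigr => l _; rewrite yz.
  case: (yE B) => [/excess_eq ->|[a aB /excess_eq ->]].
    rewrite /sign_excess (eq_bigr (x B)) => [|l _]; first by rewrite x0.
    by have := x1 B l; lia.
  have [_ _ mP] := mateP a; move: mP; rewrite aB => mP.
  by apply: transfer_sign_excess; rewrite // eq_sym.
have yD : (\sum_B y B l = D l + \sum_(a | Z a) s a * e a l)%R.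
  rewrite big_split /=; congr (_ + _)%R.
  by rewrite (partition_big home xpredT).
have Dmate a : Z a -> `|D (mate a)| = 1.
  move=> Za; have := D1 (mate a); rewrite -/(D _).
  have : D (mate a) <> 0%R.
    move=> /eqP Zm; case/eqP: (mateN a); apply: esym; exact: Zuniq (a_mate a).
  lia.
have [even|_] := boolP (all_components_even A).
  have Dnz a : ~~ Z a by apply/eqP; apply: (all_even_nonzero xA x0 D1 Duniq even).
  rewrite yD big_pred0 ?addr0 => [|a]; last exact: negbTE.
  by split; [apply/eqP; apply: Dnz | apply: D1].
have [a /andP[Za al]|none] := pickP [pred a | Z a && ((l == a) || (l == mate a))].
  (* [l] is connected to every column whose correction reaches it. *)
  have other a' : Z a' -> a' != a -> e a' l = 0%R.
    move=> Za' na'; have con b : (l == b) || (l == mate b) ->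
        connect (incidence A) (inr b) (inr l).
      by case/orP=> /eqP ->; [exact: connect0 | exact: a_mate].
    have := con a'; rewrite /e; case: (l == a') (l == mate a') => [] [] //= cona';
    by case/eqP: na'; apply: Zuniq => //; apply: connect_trans (cona' isT) _;
      rewrite (sym_connect_sym (incidence_sym A)) con.
  rewrite yD (bigD1 a) //= big1 ?addr0 => [|a' /andP[Za' na']]; last first.
    by rewrite other ?mulr0.
  have := Dmate a Za; have := mateN a; rewrite /e /s.
  move: al Za; have [-> _|_ /= /eqP ->] := eqVneq l a.
    by rewrite eq_sym => /eqP -> /negPf ->; lia.
  by rewrite eqxx; lia.
rewrite yD big1 ?addr0 => [|a Za]; last first.
  by have := none a; rewrite /= Za /e => /norP[/negPf -> /negPf ->]; rewrite subrr mulr0.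
have Dl0 : D l <> 0%R.
  by move=> /eqP Zl; have := none l; rewrite /= /Z /D Zl eqxx.
by split=> //; apply: leq_trans (D1 l) _.
Qed.

Lemma discrepancy_attained (I Omega : finType) (A : I -> {set Omega}) :
  (forall B, 2 <= #|A B|) -> (forall l, exists B, l \in A B) ->
  exists2 k, attained A k & k <= if all_components_even A then 1 else 2.
Proof.
move=> A2 Acov; have [y [yA y2 y0 ye yD]] := corrected_family A2 Acov.
have [J JP] := fin_all_exists (fun B => half_sets_of_vector (yA B) (y2 B) (y0 B) (ye B)).
pose J0 B := (J B).1.1; pose J1 B := (J B).1.2; pose Js B := (J B).2.
have DE l : discrepancy J0 J1 Js l = (\sum_B y B l)%R.
  by apply: eq_bigr => B _; have [_ _ _ ->] := JP B.
exists (max_discrepancy J0 J1 Js).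
  exists J0, J1, Js; split=> //; split=> [B|B|B|l]; try by have [] := JP B.
  by rewrite DE; have [] := yD l.
by apply/bigmax_leqP => l _; rewrite DE; have [] := yD l.
Qed.

Theorem theorem4p3 (Omega I : finType) (A : I -> {set Omega})
    (Omega_nonempty : 0 < #|Omega|)
    (A_ge2 : forall B : I, 2 <= #|A B|)
    (A_cover : forall l : Omega, exists B : I, l \in A B) :
  is_minimum (attained A) (if all_components_even A then 1 else 2).
Proof.
split=> [|k]; last exact: discrepancy_lower_bound.
have [k Ak k_le] := discrepancy_attained A_ge2 A_cover.
suff -> : (if all_components_even A then 1 else 2) = k by [].
by apply/eqP; rewrite eqn_leq k_le discrepancy_lower_bound.
Qed.
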